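(* Let $V$ be a finite dimensional irreducible $gl_d$-module and $\alpha\in\mathbb{C}^d$. Then $V\otimes\mathbb{C}_q$ is an irreducible module over the Lie algebra $\mathrm{Der}(\mathbb{C}_q)\ltimes\mathbb{C}_q$ with the following actions, where $v(n):=v\otimes t^n$ for $v\in V$, $n\in\mathbb{Z}^d$: (1) $\mathrm{ad}\,t^s\,v(n)=(\sigma(s,n)-\sigma(n,s))\,v(n+s)$ for $s\in\mathbb{Z}^d\setminus\mathrm{rad}(f)$; (2) $D(u,r)v(n)=\sigma(r,n)\big(((u,n+\alpha)+ru^T)v\big)(r+n)$ for $r\in\mathrm{rad}(f)$, $u\in\mathbb{C}^d$; (3) $t^mv(n)=\sigma(m,n)\,v(m+n)$ for $m\in\mathbb{Z}^d$.
   Context: All vector spaces are over $\mathbb{C}$, and $(u,n)=\sum_i u_i n_i$ for $u,n\in\mathbb{C}^d$. Let $q=(q_{ij})$ be a $d\times d$ matrix whose entries are roots of unity, with $q_{ii}=1$ and $q_{ij}^{-1}=q_{ji}$. The quantum torus $\mathbb{C}_q$ is the unital associative algebra generated by $t_1^{\pm1},\dots,t_d^{\pm1}$ with relations $t_it_i^{-1}=t_i^{-1}t_i=1$, $t_it_j=q_{ij}t_jt_i$. For $n\in\mathbb{Z}^d$ put $t^n=t_1^{n_1}\cdots t_d^{n_d}$; these form a basis of $\mathbb{C}_q$. Put $\sigma(n,m)=\prod_{1\le i<j\le d}q_{ji}^{n_jm_i}$ and $f(n,m)=\sigma(n,m)\sigma(m,n)^{-1}$, so $t^nt^m=\sigma(n,m)t^{n+m}$.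 Let $\mathrm{rad}(f)=\{n\in\mathbb{Z}^d: f(n,m)=1\ \forall m\in\mathbb{Z}^d\}$. $\mathrm{Der}(\mathbb{C}_q)$ is the Lie algebra of derivations of $\mathbb{C}_q$. Let $\partial_i(t^n)=n_it^n$, let $D(u,r)=t^r\sum_i u_i\partial_i$ for $u\in\mathbb{C}^d$, $r\in\mathrm{rad}(f)$, and let $\mathrm{ad}\,t^s$ be the inner derivation $t^m\mapsto(\sigma(s,m)-\sigma(m,s))t^{s+m}$ (zero if $s\in\mathrm{rad}(f)$). $\mathrm{Der}(\mathbb{C}_q)$ is spanned by all $D(u,r)$ ($u\in\mathbb{C}^d$, $r\in\mathrm{rad}(f)$) and all $\mathrm{ad}\,t^s$ ($s\notin\mathrm{rad}(f)$), with brackets $[\mathrm{ad}\,t^s,\mathrm{ad}\,t^r]=(\sigma(s,r)-\sigma(r,s))\,\mathrm{ad}\,t^{s+r}$; $[D(u,r),\mathrm{ad}\,t^s]=(u,s)\sigma(r,s)\,\mathrm{ad}\,t^{r+s}$; $[D(u,r),D(u',r')]=D(w,r+r')$ with $w=\sigma(r,r')((u,r')u'-(u',r)u)$. The Lie algebra $\mathrm{Der}(\mathbb{C}_q)\ltimes\mathbb{C}_q$ contains $\mathrm{Der}(\mathbb{C}_q)$ as a subalgebra and $\mathbb{C}_q$ as an ideal, with brackets $[D(u,r),t^n]=(u,n)\sigma(r,n)t^{r+n}$, $[\mathrm{ad}\,t^s,t^n]=(\sigma(s,n)-\sigma(n,s))t^{s+n}$, $[t^m,t^n]=(\sigma(m,n)-\sigma(n,m))t^{m+n}$.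 For $r\in\mathbb{Z}^d$, $u\in\mathbb{C}^d$, $ru^T=\sum_{i,j}r_iu_jE_{ij}\in gl_d$, where $E_{ij}$ are the matrix units, acting on $V$ through the $gl_d$-module structure. *)

(* Defs.v *)
From HB Require Import structures.
From mathcomp Require Import all_boot all_order all_algebra.
From mathcomp Require Import finmap boolp functions reals.
From mathcomp Require Import complex monalg.

Set Implicit Arguments.
Unset Strict Implicit.
Unset Printing Implicit Defensive.

Import GRing.Theory.
Local Open Scope ring_scope.

Section LieModules.
Variable K : fieldType.

Definition lie_module (L W : lmodType K) (br : L -> L -> L)
    (rho : L -> W -> W) : Prop :=
  bilinear_for *:%R *:%R rho /\
  forall x y w, rho (br x y) w = rho x (rho y w) - rho y (rho x w).

Definition submodule (L W : lmodType K) (rho : L -> W -> W) (P : W -> Prop) :=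
  [/\ P 0,
      forall (a : K) w w', P w -> P w' -> P (a *: w + w')
    & forall x w, P w -> P (rho x w)].

Definition irreducible (L W : lmodType K) (rho : L -> W -> W) : Prop :=
  (exists w : W, w <> 0) /\
  forall P, submodule rho P -> (forall w, P w -> w = 0) \/ (forall w, P w).

(* The Lie bracket of gl_d; 'M_d carries no ring structure for general d. *)
Definition gl_bracket (d : nat) (X Y : 'M[K]_d) : 'M[K]_d :=
  X *m Y - Y *m X.

(* Universal property: (W, tens) is the tensor product of V and A over K. *)
Definition is_tensor_product (V A W : lmodType K) (tens : V -> A -> W) : Prop :=
  bilinear_for *:%R *:%R tens /\
  forall (U : lmodType K) (b : V -> A -> U), bilinear_for *:%R *:%R b ->
  exists g : {linear W -> U},
    (forall v a, g (tens v a) = b v a) /\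
    forall h : {linear W -> U}, (forall v a, h (tens v a) = b v a) -> h =1 g.

End LieModules.

Section Derivations.
Variables (K : fieldType) (A : algType K).

Definition derivation (D : A -> A) : Prop :=
  linear D /\ forall a b, D (a * b) = D a * b + a * D b.

Definition is_derivation : {pred A -> A} := fun D => `[< derivation D >].

Lemma is_derivation_submod : submod_closed is_derivation.
Proof.
split=> [|c D E /asboolP[lD mD] /asboolP[lE mE]]; apply/asboolP; split.
- by move=> k x y /=; rewrite scaler0 addr0.
- by move=> a b /=; rewrite mul0r mulr0 addr0.
- move=> k x y; change (c *: D (k *: x + y) + E (k *: x + y) =
    k *: (c *: D x + E x) + (c *: D y + E y)).
  rewrite lD lE !scalerDr !scalerA (mulrC c k) -!addrA; congr (_ + _).
  by rewrite !addrA; congr (_ + _); rewrite addrC.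
- move=> a b; change (c *: D (a * b) + E (a * b) =
    (c *: D a + E a) * b + a * (c *: D b + E b)).
  rewrite mD mE scalerDr mulrDl mulrDr -scalerAl -scalerAr -!addrA.
  by congr (_ + _); rewrite addrCA.
Qed.

HB.instance Definition _ :=
  GRing.isSubmodClosed.Build K (A -> A) is_derivation is_derivation_submod.

(* Der(A), as a subspace of the space of all maps A -> A. *)
Record der := MkDer { der_fun :> A -> A; _ : der_fun \in is_derivation }.

HB.instance Definition _ := [isSub for der_fun].
HB.instance Definition _ := [Choice of der by <:].
HB.instance Definition _ := [SubChoice_isSubLmodule of der by <:].

Definition to_der (D : A -> A) (hD : derivation D) : der :=
  MkDer (asboolT hD : D \in is_derivation).

Lemma derivationP (D : der) : derivation D.
Proof. by case: D => D /= /asboolP. Qed.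

Lemma der_bracket_subproof (D E : der) :
  derivation (fun a => D (E a) - E (D a)).
Proof.
have [lD mD] := derivationP D; have [lE mE] := derivationP E.
have aD x y : D (x + y) = D x + D y by have := lD 1 x y; rewrite !scale1r.
have aE x y : E (x + y) = E x + E y by have := lE 1 x y; rewrite !scale1r.
split=> [k x y | a b].
  by rewrite lE lD lD lE opprD scalerBr addrACA.
rewrite mE mD aD aE !mD !mE mulrBl mulrBr.
rewrite [X in X - _](AC (2*2) ((1*4)*(2*3))).
rewrite [X in _ - X](AC (2*2) ((1*4)*(3*2))).
by rewrite opprD addrACA subrr addr0 opprD addrACA.
Qed.

Definition der_bracket (D E : der) : der :=
  to_der (der_bracket_subproof D E).

Lemma ad_subproof (a : A) : derivation (fun b => a * b - b * a).
Proof.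
split=> [k x y | x y].
  by rewrite mulrDr mulrDl -scalerAl -scalerAr opprD scalerBr addrACA.
by rewrite mulrBl mulrBr !mulrA addrA subrK.
Qed.

Definition ad (a : A) : der := to_der (ad_subproof a).

Lemma central_derivation (c : A) (E : A -> A) :
  (forall a, c * a = a * c) -> derivation E -> derivation (fun a => c * E a).
Proof.
move=> hc [lE mE]; split=> [k x y | x y].
  by rewrite lE mulrDr scalerAr.
by rewrite mE mulrDr !mulrA (hc x).
Qed.

(* Der(A) |x A : the pair (D, a) stands for D + a. *)
Definition semidirect_bracket (x y : der * A) : der * A :=
  (der_bracket x.1 y.1,
   x.1 y.2 - y.1 x.2 + (x.2 * y.2 - y.2 * x.2)).

End Derivations.

Section QuantumTorus.
Variables (K : fieldType) (d : nat).

Record qmatrix := QMatrix {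
  qentry :> 'M[K]_d;
  qentry_root : forall i j, exists2 k, (0 < k)%N & qentry i j ^+ k = 1;
  qentry_diag : forall i, qentry i i = 1;
  qentry_inv : forall i j, (qentry i j)^-1 = qentry j i
}.

Local Notation lat := 'rV[int]_d.
Implicit Types (q : qmatrix) (n m r s : lat).

Definition sigma q n m : K :=
  \prod_(i < d) \prod_(j < d | (i < j)%N) q j i ^ (n 0 j * m 0 i).

Definition fcocycle q n m : K := sigma q n m / sigma q m n.

Definition radf q n : Prop := forall m, fcocycle q n m = 1.

Definition pairing (u v : 'rV[K]_d) : K := \sum_i u 0 i * v 0 i.

Definition zvec n : 'rV[K]_d := map_mx intr n.

(* The matrix r u^T. *)
Definition outer r (u : 'rV[K]_d) : 'M[K]_d :=
  \matrix_(i, j) ((r 0 i)%:~R * u 0 j).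

Lemma qentry_neq0 q i j : q i j != 0.
Proof.
have [k k0 qk] := qentry_root q i j; apply/eqP => q0.
by move/eqP: qk; rewrite q0 expr0n eqn0Ngt k0 eq_sym oner_eq0.
Qed.

Lemma sigmaDl q n n' m : sigma q (n + n') m = sigma q n m * sigma q n' m.
Proof.
rewrite -big_split; apply: eq_bigr => i _; rewrite -big_split.
by apply: eq_bigr => j _; rewrite mxE mulrDl expfzDr ?qentry_neq0.
Qed.

Lemma sigmaDr q n m m' : sigma q n (m + m') = sigma q n m * sigma q n m'.
Proof.
rewrite -big_split; apply: eq_bigr => i _; rewrite -big_split.
by apply: eq_bigr => j _; rewrite mxE mulrDr expfzDr ?qentry_neq0.
Qed.

Lemma sigma0l q m : sigma q 0 m = 1.
Proof. by rewrite /sigma big1 // => i _; rewrite big1 // => j _; rewrite mxE mul0r. Qed.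

Lemma sigma0r q n : sigma q n 0 = 1.
Proof. by rewrite /sigma big1 // => i _; rewrite big1 // => j _; rewrite mxE mulr0. Qed.

Lemma sigma_neq0 q n m : sigma q n m != 0.
Proof.
apply/prodf_neq0 => i _; apply/prodf_neq0 => j _.
by rewrite expfz_neq0 ?qentry_neq0.
Qed.

Lemma radf_sigma q r m : radf q r -> sigma q r m = sigma q m r.
Proof. by move/(_ m)/divr1_eq. Qed.

(* C_q is realized on the free module with basis (t^n)_(n in Z^d), with the
   product determined by t^n t^m = sigma(n, m) t^(n+m); the presentation by
   generators and relations is recovered in [tgenK], [tgenVK], [tgen_rel]
   and [tX_monomial] below. *)
Definition qtorus q := {malg K[lat]}.
HB.instance Definition _ q := GRing.Lmodule.on (qtorus q).

(* tX and qt_mul are locked: conversion would otherwise unfold the underlying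
   finitely supported functions. *)
Fact qt_key : unit. Proof. exact: tt. Qed.

Definition tX q : lat -> qtorus q :=
  locked_with qt_key (fun n : lat => mkmalgU n (1 : K)).

Lemma tXE q n : tX q n = mkmalgU n (1 : K).
Proof. by rewrite /tX unlock. Qed.

Definition qlift q (M : lmodType K) (g : lat -> M) (x : qtorus q) : M :=
  \sum_(n <- msupp x) x@_n *: g n.

Lemma qliftEw q (M : lmodType K) (g : lat -> M) (x : qtorus q)
    (S : {fset lat}) :
  (msupp x `<=` S)%fset -> qlift g x = \sum_(n <- S) x@_n *: g n.
Proof.
move=> xS; rewrite /qlift (big_fset_incl _ xS) //= => n _.
by move/mcoeff_outdom ->; rewrite scale0r.
Qed.

Lemma qlift_is_linear q (M : lmodType K) (g : lat -> M) :
  linear (@qlift q M g).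
Proof.
move=> a x y; set z := a *: x + y.
set S := (msupp x `|` msupp y `|` msupp z)%fset.
have xS : (msupp x `<=` S)%fset by rewrite /S -fsetUA fsubsetUl.
have yS : (msupp y `<=` S)%fset by rewrite /S fsetUAC fsubsetUr.
have zS : (msupp z `<=` S)%fset by rewrite fsubsetUr.
rewrite (qliftEw _ xS) (qliftEw _ yS) (qliftEw _ zS).
rewrite scaler_sumr -big_split; apply: eq_bigr => n _ /=.
by rewrite mcoeffD mcoeffZ scalerDl scalerA.
Qed.

HB.instance Definition _ q (M : lmodType K) (g : lat -> M) :=
  GRing.isLinear.Build K (qtorus q) M *:%R (@qlift q M g)
    (@qlift_is_linear q M g).

Lemma qliftX q (M : lmodType K) (g : lat -> M) n : qlift g (tX q n) = g n.
Proof.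
rewrite tXE (@qliftEw _ _ _ _ [fset n]%fset) ?msuppU_le //.
by rewrite big_seq_fset1 mcoeffUU scale1r.
Qed.

Lemma qtorusE q (x : qtorus q) : x = qlift (tX q) x.
Proof.
rewrite [LHS]monalgE /qlift; apply: eq_bigr => n _; rewrite tXE.
apply/malgP => k; rewrite [LHS]mcoeffU [RHS]mcoeffZ.
by rewrite [X in _ = _ * X]mcoeffU mulrnAr mulr1.
Qed.

Lemma qt_ind q (P : qtorus q -> Prop) :
  (forall n, P (tX q n)) ->
  (forall (a : K) x y, P x -> P y -> P (a *: x + y)) -> forall x, P x.
Proof.
move=> PX PD x.
have P0 : P 0 by have := PD (-1) _ _ (PX 0) (PX 0); rewrite scaleN1r addNr.
rewrite (qtorusE x) /qlift; elim: (X in bigop.body _ X) => [|n s IH].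
  by rewrite big_nil.
by rewrite big_cons; apply: PD.
Qed.

Definition qt_mul q : qtorus q -> qtorus q -> qtorus q :=
  locked_with qt_key (fun x y : qtorus q =>
    qlift (fun n => qlift (fun m => sigma q n m *: tX q (n + m)) y) x).

Lemma qt_mulE q (x y : qtorus q) : qt_mul x y =
  qlift (fun n => qlift (fun m => sigma q n m *: tX q (n + m)) y) x.
Proof. by rewrite /qt_mul unlock. Qed.

Lemma qt_mulXX q n m : qt_mul (tX q n) (tX q m) = sigma q n m *: tX q (n + m).
Proof. by rewrite qt_mulE !qliftX. Qed.

Lemma qt_mul_linl q (a : K) (x y z : qtorus q) :
  qt_mul (a *: x + y) z = a *: qt_mul x z + qt_mul y z.
Proof. by rewrite !qt_mulE linearP. Qed.

Lemma qt_mul_linr q (a : K) (x y z : qtorus q) :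
  qt_mul z (a *: x + y) = a *: qt_mul z x + qt_mul z y.
Proof.
rewrite !qt_mulE /qlift scaler_sumr -big_split /=.
by apply: eq_bigr => n _; rewrite -!/(qlift _ _) linearP scalerDr !scalerA mulrC.
Qed.

Lemma qt_mulDl q : left_distributive (@qt_mul q) +%R.
Proof. by move=> x y z; have := qt_mul_linl 1 x y z; rewrite !scale1r. Qed.

Lemma qt_mulDr q : right_distributive (@qt_mul q) +%R.
Proof. by move=> z x y; have := qt_mul_linr 1 x y z; rewrite !scale1r. Qed.

Lemma qt_mulZl q (a : K) (x y : qtorus q) :
  qt_mul (a *: x) y = a *: qt_mul x y.
Proof.
apply: (@addIr _ (qt_mul 0 y)); rewrite -qt_mul_linl.
by rewrite -qt_mulDl.
Qed.

Lemma qt_mulZr q (a : K) (x y : qtorus q) :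
  qt_mul x (a *: y) = a *: qt_mul x y.
Proof.
apply: (@addIr _ (qt_mul x 0)); rewrite -qt_mul_linr.
by rewrite -qt_mulDr.
Qed.

Lemma qt_mulA q : associative (@qt_mul q).
Proof.
move=> x y z; elim/qt_ind: x => [n|a x x' Hx Hx']; last first.
  rewrite (qt_mul_linl a x x' y) (qt_mul_linl a x x' (qt_mul y z)).
  by rewrite (qt_mul_linl a (qt_mul x y) (qt_mul x' y)) Hx Hx'.
elim/qt_ind: y => [m|a y y' Hy Hy']; last first.
  rewrite (qt_mul_linl a y y' z) (qt_mul_linr a y y').
  rewrite (qt_mul_linr a (qt_mul y z) (qt_mul y' z)).
  by rewrite (qt_mul_linl a (qt_mul (tX q n) y) (qt_mul (tX q n) y')) Hy Hy'.
elim/qt_ind: z => [r|a z z' Hz Hz']; last first.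
  rewrite (qt_mul_linr a z z' (tX q m)) (qt_mul_linr a z z').
  rewrite (qt_mul_linr a (qt_mul (tX q m) z) (qt_mul (tX q m) z')).
  by rewrite Hz Hz'.
rewrite !qt_mulXX qt_mulZl qt_mulZr !qt_mulXX 2!scalerA sigmaDl sigmaDr addrA.
move: (sigma q n m) (sigma q m r) (sigma q n r) => a b c.
by rewrite [X in X *: _ = _]mulrCA [b * c]mulrC.
Qed.

Lemma qt_mul1l q : left_id (tX q 0) (@qt_mul q).
Proof.
move=> x; elim/qt_ind: x => [n|a x y Hx Hy]; last by rewrite qt_mul_linr Hx Hy.
by rewrite qt_mulXX sigma0l add0r scale1r.
Qed.

Lemma qt_mul1r q : right_id (tX q 0) (@qt_mul q).
Proof.
move=> x; elim/qt_ind: x => [n|a x y Hx Hy]; last by rewrite qt_mul_linl Hx Hy.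
by rewrite qt_mulXX sigma0r addr0 scale1r.
Qed.

Lemma qt_1_neq0 q : tX q 0 != 0.
Proof. by rewrite tXE monalgU_eq0 oner_eq0. Qed.

HB.instance Definition _ q := GRing.Zmodule_isNzRing.Build (qtorus q)
  (@qt_mulA q) (@qt_mul1l q) (@qt_mul1r q) (@qt_mulDl q) (@qt_mulDr q)
  (qt_1_neq0 q).

Lemma qt_scaleAl q (a : K) (x y : qtorus q) : a *: (x * y) = (a *: x) * y.
Proof. by rewrite [LHS](esym (qt_mulZl a x y)). Qed.

Lemma qt_scaleAr q (a : K) (x y : qtorus q) : a *: (x * y) = x * (a *: y).
Proof. by rewrite [LHS](esym (qt_mulZr a x y)). Qed.

HB.instance Definition _ q :=
  GRing.Lmodule_isLalgebra.Build K (qtorus q) (@qt_scaleAl q).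
HB.instance Definition _ q :=
  GRing.Lalgebra_isAlgebra.Build K (qtorus q) (@qt_scaleAr q).

Lemma tXM q n m : tX q n * tX q m = sigma q n m *: tX q (n + m).
Proof. exact: qt_mulXX. Qed.

Lemma tX0 q : tX q 0 = 1.
Proof. by []. Qed.

(* t_i, t_i^-1 and t_i^k *)
Definition tgen q (i : 'I_d) : qtorus q := tX q (delta_mx 0 i).
Definition tgenV q (i : 'I_d) : qtorus q := tX q (- delta_mx 0 i).
Definition tgen_exp q (i : 'I_d) (k : int) : qtorus q :=
  match k with Posz n => tgen q i ^+ n | Negz n => tgenV q i ^+ n.+1 end.

Lemma sigma_delta q (i j : 'I_d) (k l : int) :
  sigma q (k *: delta_mx 0 i) (l *: delta_mx 0 j) =
  if (j < i)%N then q i j ^ (k * l) else 1.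
Proof.
have E (a b : 'I_d) : ((k *: delta_mx 0 i : lat) 0 b) * ((l *: delta_mx 0 j : lat) 0 a)
    = (k * l) *+ ((b == i) && (a == j)).
  rewrite !mxE !eqxx /=; case: (b == i); last by rewrite mulr0 mul0r.
  by case: (a == j); rewrite ?mulr1 ?mulr0.
rewrite /sigma; under eq_bigr => a _ do under eq_bigr => b _ do rewrite E.
case: ltnP => [ji|ij].
  rewrite (bigD1 j) //= (bigD1 i) //= !eqxx big1 ?mulr1 => [|b /andP[_ bi]].
    rewrite big1 ?mulr1 // => a aj; apply: big1 => b _.
    by rewrite (negPf aj) andbF.
  by rewrite (negPf bi).
apply: big1 => a _; apply: big1 => b ab.
case: eqP => [bi|//]; case: eqP => [aj|//].
by move: ab; rewrite bi aj ltnNge ij.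
Qed.

Lemma tgenK q i : tgen q i * tgenV q i = 1.
Proof.
rewrite tXM -[delta_mx 0 i]scale1r -scaleNr sigma_delta ltnn.
by rewrite -scalerDl subrr !scale0r scale1r.
Qed.

Lemma tgenVK q i : tgenV q i * tgen q i = 1.
Proof.
rewrite tXM -[delta_mx 0 i]scale1r -scaleNr sigma_delta ltnn.
by rewrite -scalerDl addNr !scale0r scale1r.
Qed.

Lemma tgen_rel q i j : tgen q i * tgen q j = q i j *: (tgen q j * tgen q i).
Proof.
rewrite !tXM scalerA [delta_mx 0 j + _]addrC.
apply: (congr1 (fun c => c *: _)).
rewrite -[delta_mx 0 i]scale1r -[delta_mx 0 j]scale1r !sigma_delta mulr1.
rewrite !expr1z; case: ltngtP => [_|_|/val_inj->].
- by rewrite mulr1.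
- by rewrite -qentry_inv mulVf ?mulfV ?qentry_neq0.
- by rewrite qentry_diag mulr1.
Qed.

Lemma tgen_expE q i k : tgen_exp q i k = tX q (k *: delta_mx 0 i).
Proof.
have pow (l : int) (n : nat) : tX q (l *: delta_mx 0 i) ^+ n =
    tX q ((l * n%:Z) *: delta_mx 0 i).
  elim: n => [|n IH]; first by rewrite mulr0 scale0r.
  rewrite exprS IH tXM sigma_delta ltnn scale1r -scalerDl -{1}[l]mulr1 -mulrDr.
  by rewrite -PoszD add1n.
case: k => n; rewrite /tgen_exp /tgen /tgenV.
  by rewrite -{1}[delta_mx 0 i]scale1r pow mul1r.
by rewrite -[- _]scaleN1r pow mulN1r NegzE.
Qed.

Lemma tX_monomial q n : tX q n = \prod_(i < d) tgen_exp q i (n 0 i).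
Proof.
have srt : sorted ltn (map val (index_enum 'I_d)).
  by rewrite -[index_enum _]enumT val_enum_ord iota_ltn_sorted.
rewrite {1}[n]matrix_sum_delta big_ord1.
elim: (index_enum _) srt => [|i s IH] /= srt; first by rewrite !big_nil tX0.
rewrite !big_cons -IH ?(path_sorted srt) // tgen_expE tXM.
set m := \sum_(j <- s) _; suff E : sigma q (n ord0 i *: delta_mx ord0 i) m = 1.
  by rewrite E scale1r.
rewrite {}/m.
have {IH} : all (fun j : 'I_d => (i < j)%N) s.
  have := order_path_min ltn_trans srt; by rewrite all_map.
elim: s {srt} => [|j s IH] /= => [_|]; first by rewrite big_nil sigma0r.
case/andP=> ij /IH Hs; rewrite big_cons sigmaDr Hs mulr1 sigma_delta.
by rewrite ltnNge (ltnW ij).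
Qed.

(* The degree derivation d_i, with t^n |-> n_i t^n. *)
Definition degree_fun q (i : 'I_d) : qtorus q -> qtorus q :=
  qlift (fun n => (n 0 i)%:~R *: tX q n).

Lemma degree_funX q i n :
  degree_fun i (tX q n) = (n 0 i)%:~R *: tX q n.
Proof. exact: qliftX. Qed.

Lemma degree_subproof q i : derivation (@degree_fun q i).
Proof.
have lD : linear (@degree_fun q i) by move=> a x y; exact: linearP.
split=> //; elim/qt_ind => [n|a x x' Hx Hx'] y; last first.
  by rewrite !mulrDl -!scalerAl !lD Hx Hx' !mulrDl -!scalerAl scalerDr addrACA.
elim/qt_ind: y => [m|a y y' Hy Hy']; last first.
  by rewrite !mulrDr -!scalerAr !lD Hy Hy' !mulrDr -!scalerAr scalerDr addrACA.
have lZ a x : degree_fun i (a *: x) = a *: degree_fun i x.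
  by rewrite /degree_fun linearZ.
rewrite tXM lZ !degree_funX -scalerAl -scalerAr tXM -scalerDl.
by rewrite !scalerA mxE intrD mulrC.
Qed.

Lemma rad_central q r : radf q r -> forall x, tX q r * x = x * tX q r.
Proof.
move=> hr; elim/qt_ind => [m|a x y Hx Hy].
  by rewrite !tXM (radf_sigma _ hr) addrC.
by rewrite mulrDr mulrDl -scalerAr -scalerAl Hx Hy.
Qed.

Lemma torusD_subproof q (u : 'rV[K]_d) r (hr : radf q r) :
  derivation (fun x : qtorus q =>
    tX q r * \sum_i u 0 i *: degree_fun i x).
Proof.
apply: (central_derivation (rad_central hr)); split=> [a x y|x y].
  rewrite scaler_sumr -big_split; apply: eq_bigr => i _ /=.
  by rewrite (degree_subproof q i).1 scalerDr !scalerA mulrC.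
rewrite mulr_suml mulr_sumr -big_split; apply: eq_bigr => i _ /=.
rewrite (degree_subproof q i).2 scalerDr.
by rewrite -[in RHS]scalerAl -[in RHS]scalerAr.
Qed.

(* D(u, r) = t^r (u_1 d_1 + ... + u_d d_d), for r in rad(f). *)
Definition torusD q (u : 'rV[K]_d) r (hr : radf q r) : der (qtorus q) :=
  to_der (torusD_subproof u hr).

End QuantumTorus.

(* Main.v *)
(* The action extends to an arbitrary derivation D of C_q, with no choice of a
   decomposition of D into outer and inner parts.  Let pi be the projection of
   C_q onto the span of the t^r, r in rad(f); it satisfies pi(xy) = pi(yx), its
   image is the centre, and it commutes with every derivation.  The central
   elements f_j(D) = pi(t_j^-1 D(t_j)) vanish on inner derivations, describe D on
   the centre (D z = sum_j f_j(D) d_j(z)) and satisfy the cocycle identity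
   f_j([D, E]) = D(f_j(E)) - E(f_j(D)).  Hence
     D . (v (x) a) = v (x) (D a + sum_j alpha_j f_j(D) a)
                     + sum_(i, j) E_ij v (x) d_i(f_j(D)) a
   is a Lie action, the terms quadratic in d_i(f_j) matching because V is a
   gl_d-module.

   For irreducibility, the operators D(e_i, 0) separate the degrees, so a
   submodule is graded; the t^m identify all its homogeneous components with one
   subspace of V; and this subspace is gl_d-stable because N Z^d lies in rad(f)
   for a common order N of the q_ij, so that D(e_j, N e_i) acts on it as a scalar
   plus N E_ij. *)

Require Import Defs.
From HB Require Import structures.
From mathcomp Require Import all_boot all_order all_algebra.
From mathcomp Require Import finmap boolp reals complex monalg.

Set Implicit Arguments.
Unset Strict Implicit.
Unset Printing Implicit Defensive.

Import GRing.Theory Num.Theory.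
Local Open Scope ring_scope.
Local Open Scope complex_scope.

(** * Rules of computation for maps known only to satisfy [linear] *)

Section LinearMaps.
Variables (K : fieldType) (U V : lmodType K) (f : U -> V).
Hypothesis lf : linear f.

Let g : {linear U -> V} := HB.pack f (GRing.isLinear.Build K U V *:%R f lf).

Lemma lin0 : f 0 = 0. Proof. exact: (linear0 g). Qed.
Lemma linD x y : f (x + y) = f x + f y. Proof. exact: (linearD g). Qed.
Lemma linB x y : f (x - y) = f x - f y. Proof. exact: (linearB g). Qed.
Lemma linZ a x : f (a *: x) = a *: f x. Proof. exact: (linearZ_LR g). Qed.
Lemma lin_sum (I : Type) (r : seq I) (P : pred I) (F : I -> U) :
  f (\sum_(i <- r | P i) F i) = \sum_(i <- r | P i) f (F i).
Proof. exact: (linear_sum g). Qed.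

End LinearMaps.

(** * Generation of the tensor product by pure tensors *)

Section SpanOfTensors.
Variables (K : fieldType) (V A W : lmodType K) (tens : V -> A -> W).

(** Sums without coefficients suffice, since the first factor of a tensor absorbs scalars. *)
Definition in_tspan : {pred W} :=
  fun w => `[< exists s : seq (V * A), w = \sum_(p <- s) tens p.1 p.2 >].

Hypothesis hW : is_tensor_product tens.

Lemma in_tspan_submod : submod_closed in_tspan.
Proof.
split=> [|a x y /asboolP[s ->] /asboolP[s' ->]]; apply/asboolP.
  by exists [::]; rewrite big_nil.
exists ([seq (a *: p.1, p.2) | p <- s] ++ s').
rewrite big_cat big_map scaler_sumr; congr (_ + _).
by apply: eq_bigr => p _; rewrite (linZ (hW.1.1 p.2)).
Qed.

HB.instance Definition _ :=
  GRing.isSubmodClosed.Build K W in_tspan in_tspan_submod.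

Record tspan := MkTspan { tspan_val : W; _ : tspan_val \in in_tspan }.

HB.instance Definition _ := [isSub for tspan_val].
HB.instance Definition _ := [Choice of tspan by <:].
HB.instance Definition _ := [SubChoice_isSubLmodule of tspan by <:].

Lemma tens_in_tspan v a : tens v a \in in_tspan.
Proof. by apply/asboolP; exists [:: (v, a)]; rewrite big_seq1. Qed.

(* The bilinear map [tens] factors through the span of its image; by
   uniqueness the resulting projection of W onto the span is the identity. *)
Lemma tensor_span w : w \in in_tspan.
Proof.
pose b v a : tspan := MkTspan (tens_in_tspan v a).
have bb : bilinear_for *:%R *:%R b.
  split=> u a x y; apply: val_inj.
    by rewrite linearP /= (hW.1.1 u).
  by rewrite linearP /= (hW.1.2 u).
have [g [gb _]] := hW.2 _ _ bb.
have [g0 [_ g0u]] := hW.2 _ _ hW.1.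
have -> : w = (\val \o g : {linear W -> W}) w.
  rewrite (g0u (\val \o g : {linear W -> W})) => [|v a]; last by rewrite /= gb.
  exact: (g0u idfun).
by rewrite /=; case: (g w).
Qed.

Lemma tensor_ind (P : W -> Prop) :
  (forall a w w', P w -> P w' -> P (a *: w + w')) ->
  (forall v a, P (tens v a)) -> forall w, P w.
Proof.
move=> PD Pt w; have /asboolP[s ->] := tensor_span w.
have P0 : P 0 by have := PD (-1) _ _ (Pt 0 0) (Pt 0 0); rewrite scaleN1r addNr.
elim: s => [|p s IH]; first by rewrite big_nil.
by rewrite big_cons -[tens _ _]scale1r; apply: PD.
Qed.

Lemma tensor_lin_ext (U : lmodType K) (g h : W -> U) : linear g -> linear h ->
  (forall v a, g (tens v a) = h (tens v a)) -> g =1 h.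
Proof.
move=> lg lh gh; apply: tensor_ind => // a w w' e e'.
by rewrite lg lh e e'.
Qed.

Lemma tensor_lift (U : lmodType K) (b : V -> A -> U) :
  bilinear_for *:%R *:%R b ->
  exists g : W -> U, linear g /\ forall v a, g (tens v a) = b v a.
Proof.
by case/hW.2 => g [gb _]; exists g; split=> // a x y; exact: linearP.
Qed.

End SpanOfTensors.

(** * The twisted action of derivations *)

Lemma der_linear (K : fieldType) (A : algType K) (D : der A) : linear D.
Proof. by case: (derivationP D). Qed.

Lemma derM (K : fieldType) (A : algType K) (D : der A) a b :
  D (a * b) = D a * b + a * D b.
Proof. by case: (derivationP D). Qed.

(** Apply [D] to [z * a = a * z]; the terms containing [D a] cancel because [z] is central. *)
Lemma der_centre (K : fieldType) (A : algType K) (D : der A) z :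
  (forall a, z * a = a * z) -> forall a, D z * a = a * D z.
Proof.
move=> zC a; have := congr1 D (zC a).
by rewrite !derM zC [in RHS]addrC => /addIr.
Qed.

(** Matches the quadratic terms of the action: products of coefficient matrices on the left, the
    multiplication rule of matrix units on the right. *)
Lemma contract_pairs (I : finType) (W : zmodType) (F : I * I -> I * I -> W) :
  \sum_e \sum_k F (e.1, k) (k, e.2) =
  \sum_e \sum_e' F e e' *+ (e.2 == e'.1).
Proof.
have pairE (G : I * I -> W) : \sum_e G e = \sum_i \sum_j G (i, j).
  by rewrite pair_bigA; apply: eq_bigr => -[].
rewrite !pairE; apply: eq_bigr => i _; rewrite exchange_big.
apply: eq_bigr => j _ /=; rewrite pairE.
rewrite [RHS](bigD1 j) //= eqxx [X in _ = _ + X]big1 ?addr0 // => k /negPf kj.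
by apply: big1 => l _; rewrite eq_sym kj.
Qed.

Section TwistedAction.
Variables (K : fieldType) (A : algType K) (d : nat).
Variables (V W : lmodType K) (tens : V -> A -> W).
Variables (rhoV : 'M[K]_d -> V -> V) (alpha : 'rV[K]_d).
Variables (p : 'I_d -> der A) (f : der A -> 'I_d -> A).
Hypothesis hW : is_tensor_product tens.
Hypothesis hV : lie_module (@gl_bracket K d) rhoV.
Hypothesis f_lin : forall j, linear (f^~ j).
Hypothesis f_centre : forall D j a, f D j * a = a * f D j.
Hypothesis f_bracket :
  forall (D E : der A) j, f (der_bracket D E) j = D (f E j) - E (f D j).
Hypothesis der_on_centre : forall (D : der A) z, (forall a, z * a = a * z) ->
  D z = \sum_j f D j * p j z.
Hypothesis p_comm : forall i j a, p i (p j a) = p j (p i a).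

Local Notation L := (der A * A)%type.
Implicit Types (x y : L) (e : 'I_d * 'I_d).

(** [T x] collects the terms that leave the factor [V] alone; [J x] is the Jacobian matrix of the
    functions [f x.1 j], whose entries weight the matrix units [E e]. *)
Let T x (a : A) := x.1 a + (\sum_j alpha 0 j *: f x.1 j) * a + x.2 * a.
Let J x e := p e.1 (f x.1 e.2).
Let E e := rhoV (delta_mx e.1 e.2).

Let T_lin x : linear (T x).
Proof.
move=> k a b; rewrite /T der_linear !mulrDr -!scalerAr !scalerDr.
by rewrite [LHS](AC (2*2*2) ((1*3*5)*(2*4*6))).
Qed.

Let T_linl a : linear (T^~ a).
Proof.
move=> k x y; rewrite /T [(k *: x + y).1 a]/=.
have -> : \sum_j alpha 0 j *: f (k *: x + y).1 j =
    k *: (\sum_j alpha 0 j *: f x.1 j) + \sum_j alpha 0 j *: f y.1 j.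
  rewrite scaler_sumr -big_split; apply: eq_bigr => j _ /=.
  by rewrite (f_lin j k x.1 y.1) scalerDr !scalerA mulrC.
rewrite !mulrDl -!scalerAl !scalerDr /=.
by rewrite [LHS](AC (2*2*2) ((1*3*5)*(2*4*6))).
Qed.

Let J_lin e : linear (J^~ e).
Proof. by move=> k x y; rewrite /J (f_lin e.2 k x.1 y.1) der_linear. Qed.

Let J_centre x e a : J x e * a = a * J x e.
Proof. exact: der_centre (f_centre _ _) _. Qed.

Let E_lin e : linear (E e).
Proof. exact: (hV.1.2 _). Qed.

Definition twisted_fun x v a : W :=
  tens v (T x a) + \sum_e tens (E e v) (J x e * a).

Let b1 v : linear (tens v). Proof. exact: (hW.1.2 v). Qed.
Let b2 a : linear (tens^~ a). Proof. exact: (hW.1.1 a). Qed.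

Let twisted_bilin x : bilinear_for *:%R *:%R (twisted_fun x).
Proof.
split=> u k w w'; rewrite /twisted_fun /=.
  rewrite (b2 _ k w w') [in RHS]scalerDr addrACA; congr (_ + _).
  rewrite scaler_sumr -big_split; apply: eq_bigr => e _ /=.
  by rewrite E_lin (b2 _ k).
rewrite T_lin b1 scalerDr addrACA; congr (_ + _).
rewrite scaler_sumr -big_split; apply: eq_bigr => e _ /=.
by rewrite mulrDr -scalerAr b1.
Qed.

Let twisted_linx v a : linear (fun x => twisted_fun x v a).
Proof.
move=> k x y; rewrite /twisted_fun (T_linl a k x y) b1 scalerDr addrACA.
congr (_ + _); rewrite scaler_sumr -big_split; apply: eq_bigr => e _ /=.
by rewrite (J_lin e k x y) mulrDl -scalerAl b1.
Qed.

(** Multiplication by [z] commutes with the two multiplicative terms of [T x], so only the Leibniz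
    term of the derivation remains. *)
Let TM x z a : (forall c, z * c = c * z) ->
  T x (z * a) = x.1 z * a + z * T x a.
Proof.
move=> zC; rewrite /T derM !mulrDr -!addrA; congr (_ + (_ + _)).
by rewrite !mulrA -!zC.
Qed.

Let T_bracket x y a :
  T (semidirect_bracket x y) a = T x (T y a) - T y (T x a).
Proof.
pose k x : A := \sum_j alpha 0 j *: f x.1 j.
have kC x0 c : k x0 * c = c * k x0.
  rewrite /k mulr_suml mulr_sumr; apply: eq_bigr => j _.
  by rewrite -scalerAl -scalerAr f_centre.
have TE x0 c : T x0 c = x0.1 c + k x0 * c + x0.2 * c by [].
have kB : k (semidirect_bracket x y) = x.1 (k y) - y.1 (k x).
  rewrite /k (lin_sum (der_linear x.1)) (lin_sum (der_linear y.1)) -sumrB.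
  apply: eq_bigr => j _.
  by rewrite f_bracket (linZ (der_linear x.1)) (linZ (der_linear y.1)) scalerBr.
(* [S] gathers the terms symmetric in [x] and [y], which drop out of the commutator; [Q] gathers the
   rest, and [kB] identifies their difference with the bracket. *)
pose S x y := (k y * x.1 a + k x * y.1 a) +
  (k y * (x.2 * a) + k x * (y.2 * a)) + (y.2 * x.1 a + x.2 * y.1 a) +
  k x * (k y * a).
pose Q x y := x.1 (y.1 a) + x.1 (k y) * a + x.1 y.2 * a + x.2 * (y.2 * a).
have TT x0 y0 : T x0 (T y0 a) = Q x0 y0 + S x0 y0.
  rewrite [T y0 a]TE TE !(linD (der_linear x0.1)) !derM !mulrDr.
  rewrite [x0.2 * (k y0 * a)]mulrA -kC -[k y0 * x0.2 * a]mulrA.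
  by rewrite [LHS](AC ((1*2)*2*3*3) ((1*2*4*11)*((3*6)*(10*8)*(5*9)*7))).
have SC : S x y = S y x.
  rewrite /S; congr (_ + _ + _ + _); try exact: addrC.
  by rewrite mulrA kC -mulrA.
rewrite !TT SC opprD addrACA subrr addr0 TE kB /Q /=.
rewrite !mulrDl !mulNr -!mulrA !opprD.
by rewrite [LHS](AC (2*2*(2*2)) ((1*3*5*7)*(2*4*6*8))).
Qed.

Let J_bracket x y e : J (semidirect_bracket x y) e =
  x.1 (J y e) - y.1 (J x e) +
  (\sum_k J x (e.1, k) * J y (k, e.2) - \sum_k J y (e.1, k) * J x (k, e.2)).
Proof.
(* Expand both derivatives along the [p k] by [der_on_centre]. The Leibniz rule for [p e.1] produces
   the product of Jacobians, and [p_comm] matches the second derivatives. *)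
have H x0 y0 : p e.1 (x0.1 (f y0.1 e.2)) =
    x0.1 (J y0 e) + \sum_k J x0 (e.1, k) * J y0 (k, e.2).
  rewrite (der_on_centre _ (f_centre y0.1 e.2)).
  rewrite (der_on_centre x0.1 (J_centre y0 e)) (lin_sum (der_linear _)).
  rewrite -big_split.
  by apply: eq_bigr => k _ /=; rewrite derM addrC /J /= p_comm.
by rewrite /J /= f_bracket (linB (der_linear _)) !H opprD addrACA.
Qed.

Let E_comm e e' v : E e (E e' v) - E e' (E e v) =
  E (e.1, e'.2) v *+ (e.2 == e'.1) - E (e'.1, e.2) v *+ (e'.2 == e.1).
Proof.
have lM : linear (rhoV^~ v) := hV.1.1 v.
rewrite -(hV.2 _ _ v) /gl_bracket !mul_delta_mx_cond (linB lM).
by congr (_ - _); case: (_ == _); rewrite ?mulr1n ?mulr0n ?(lin0 lM).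
Qed.

Let tensMn v a n : tens (v *+ n) a = tens v a *+ n.
Proof. by rewrite -!scaler_nat (linZ (b2 a)). Qed.

Lemma twisted_lie_module : exists rho : L -> W -> W,
  lie_module (@semidirect_bracket K A) rho /\
  forall x v a, rho x (tens v a) = twisted_fun x v a.
Proof.
have [rho rhoP] := choice (fun x => tensor_lift hW (twisted_bilin x)).
have lrho x : linear (rho x) := (rhoP x).1.
have rhoE x v a : rho x (tens v a) = twisted_fun x v a := (rhoP x).2 v a.
exists rho; split=> //; split.
  split=> // w k x y.
  apply: (tensor_lin_ext hW (g := rho (k *: x + y))
    (h := fun w => k *: rho x w + rho y w)) w => [||v a]; first exact: lrho.
    move=> c w w'; rewrite !lrho !scalerDr !scalerA ![k * c]mulrC.
    by rewrite -!addrA; congr (_ + _); rewrite addrCA.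
  by rewrite !rhoE (twisted_linx v a k x y).
move=> x y w.
apply: (tensor_lin_ext hW (g := rho _)
  (h := fun w => rho x (rho y w) - rho y (rho x w))) w => [||v a].
  exact: lrho.
  by move=> c w w'; rewrite !lrho opprD addrACA scalerBr.
(* The third group is symmetric in [x0] and [y0] and cancels in the commutator; the last one is
   quadratic in the Jacobians. *)
have H x0 y0 : rho x0 (rho y0 (tens v a)) = tens v (T x0 (T y0 a)) +
    \sum_e tens (E e v) (x0.1 (J y0 e) * a) +
    (\sum_e tens (E e v) (J x0 e * T y0 a) +
     \sum_e tens (E e v) (J y0 e * T x0 a)) +
    \sum_e \sum_e' tens (E e (E e' v)) (J x0 e * (J y0 e' * a)).
  rewrite rhoE (linD (lrho x0)) (lin_sum (lrho x0)) rhoE -!addrA.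
  congr (_ + _); rewrite [RHS]addrCA; congr (_ + _).
  rewrite exchange_big -!big_split; apply: eq_bigr => e _ /=.
  rewrite rhoE; rewrite /twisted_fun (TM _ _ (J_centre y0 e)) (linD (b1 _)).
  by rewrite -addrA.
rewrite rhoE !H /twisted_fun T_bracket (linB (b1 v)).
set t1 := tens v (T x _); set t2 := tens v (T y _).
set s1 := \sum_e tens _ (x.1 _ * _); set s2 := \sum_e tens _ (y.1 _ * _).
rewrite [X in _ + _ + X + _ - _]addrC; set u := (X in _ + X + _ - _).
set d1 := (X in _ + _ + X - _); set d2 := (X in _ - (_ + _ + X)).
have -> : t1 + s1 + u + d1 - (t2 + s2 + u + d2) =
    t1 - t2 + (s1 - s2 + (d1 - d2)).
  move: t1 t2 s1 s2 u d1 d2 => t1 t2 s1 s2 u d1 d2; rewrite !opprD.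
  by rewrite [LHS](AC (4*4) ((1*5)*((2*6)*(4*8))*(3*7))) /= subrr addr0.
congr (_ + _).
under eq_bigr => e _ do
  rewrite J_bracket mulrDl (linD (b1 _)) mulrBl (linB (b1 _)).
rewrite big_split sumrB; congr (_ + _).
(* Relabelling gives both double sums the same coefficient, the entries of [J] being central, so
   that their difference involves the commutator of [E e] and [E e']. *)
have -> : d2 = \sum_e \sum_e' tens (E e' (E e v)) (J x e * (J y e' * a)).
  rewrite /d2 exchange_big; apply: eq_bigr => e _; apply: eq_bigr => e' _.
  by rewrite mulrA J_centre mulrA.
rewrite /d1 -sumrB.
under [RHS]eq_bigr => e _.
  rewrite -sumrB; under eq_bigr => e' _.
    rewrite -(linB (b2 _)) E_comm (linB (b2 _)) !tensMn; over.
  rewrite sumrB; over.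
rewrite sumrB.
under eq_bigr => e _ do
  rewrite mulrBl (linB (b1 _)) !mulr_suml !(lin_sum (b1 _)).
rewrite sumrB; congr (_ - _).
  rewrite -(contract_pairs (fun e e' => tens (E (e.1, e'.2) v) _)).
  by apply: eq_bigr => -[i l] _; apply: eq_bigr => k _; rewrite mulrA.
rewrite [RHS]exchange_big /=.
rewrite -(contract_pairs (fun e e' => tens (E (e.1, e'.2) v) _)).
apply: eq_bigr => -[i l] _; apply: eq_bigr => k _.
by rewrite [in RHS]mulrA J_centre.
Qed.

End TwistedAction.

(** * Quantum tori *)

Section Cocycle.
Variables (K : fieldType) (d : nat) (q : qmatrix K d).
Implicit Types n m r : 'rV[int]_d.

Lemma sigmaNl n m : sigma q (- n) m = (sigma q n m)^-1.
Proof.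
apply: (mulfI (sigma_neq0 q n m)).
by rewrite -sigmaDl subrr sigma0l divff ?sigma_neq0.
Qed.

Lemma sigmaNr n m : sigma q n (- m) = (sigma q n m)^-1.
Proof.
apply: (mulfI (sigma_neq0 q n m)).
by rewrite -sigmaDr subrr sigma0r divff ?sigma_neq0.
Qed.

Lemma radfE r : (forall m, sigma q r m = sigma q m r) -> radf q r.
Proof. by move=> h m; rewrite /fcocycle h divff ?sigma_neq0. Qed.

Lemma radfN r : radf q r -> radf q (- r).
Proof.
by move=> hr; apply: radfE => m; rewrite sigmaNl sigmaNr (radf_sigma m hr).
Qed.

Lemma radf0 : radf q 0.
Proof. by apply: radfE => m; rewrite sigma0l sigma0r. Qed.

(* If n + m is in the radical then f(n, m) = f(n, n + m) = 1. *)
Lemma radfD_sigma n m : radf q (n + m) -> sigma q n m = sigma q m n.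
Proof.
move=> /(radf_sigma n); rewrite sigmaDl sigmaDr.
by move=> /(mulfI (sigma_neq0 q n n)).
Qed.

Lemma qentry_common_order : exists2 N, (0 < N)%N & forall i j, q i j ^+ N = 1.
Proof.
have ex (p : 'I_d * 'I_d) : exists k, (0 < k)%N /\ q p.1 p.2 ^+ k = 1.
  by have [k k0 qk] := qentry_root q p.1 p.2; exists k.
have [k kP] := choice ex.
exists (\prod_p k p)%N; first by apply: prodn_gt0 => p; case: (kP p).
move=> i j; rewrite (bigD1 (i, j)) //= exprM.
by case: (kP (i, j)) => _ ->; rewrite expr1n.
Qed.

Lemma radfMn N n : (forall i j, q i j ^+ N = 1) -> radf q (n *+ N).
Proof.
move=> qN; have z (a : int) i j : q i j ^ (a *+ N) = 1.
  by rewrite -mulr_natl natz -exprz_exp -exprnP qN exp1rz.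
by apply: radfE => m; rewrite /sigma; apply: eq_bigr => i _;
  apply: eq_bigr => j _; rewrite !mulmxnE mulrnAl mulrnAr !z.
Qed.

End Cocycle.

(* C_q enters only through an abstract basis [X] with its product and universal
   property: unification would unfold the concrete basis vectors. *)
Section TorusBasis.
Variables (K : fieldType) (d : nat) (q : qmatrix K d).
Local Notation lat := 'rV[int]_d.
Variables (A : algType K) (X : lat -> A).
Hypothesis X0 : X 0 = 1.
Hypothesis XM : forall n m, X n * X m = sigma q n m *: X (n + m).
Hypothesis X_ind : forall P : A -> Prop, (forall n, P (X n)) ->
  (forall a x y, P x -> P y -> P (a *: x + y)) -> forall x, P x.
Hypothesis X_lift : forall (M : lmodType K) (g : lat -> M),
  exists2 h : A -> M, linear h & forall n, h (X n) = g n.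
Implicit Types (n m r s : lat) (D E : der A).

Lemma torus_lin_ext (M : lmodType K) (g h : A -> M) : linear g -> linear h ->
  (forall n, g (X n) = h (X n)) -> g =1 h.
Proof.
move=> lg lh gh; apply: X_ind => // a x y e e'.
by rewrite lg lh e e'.
Qed.

Definition torus_lift (M : lmodType K) (g : lat -> M) : A -> M :=
  s2val (cid2 (X_lift g)).

Lemma torus_lift_lin (M : lmodType K) (g : lat -> M) : linear (torus_lift g).
Proof. exact: s2valP (cid2 (X_lift g)). Qed.

Lemma torus_liftX (M : lmodType K) (g : lat -> M) n : torus_lift g (X n) = g n.
Proof. exact: (s2valP' (cid2 (X_lift g))). Qed.

Definition tcoef n : A -> K^o := torus_lift (fun m => (n == m)%:R : K^o).

Lemma tcoef_lin n : linear (tcoef n). Proof. exact: torus_lift_lin. Qed.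

Lemma tcoefX n m : tcoef n (X m) = (n == m)%:R.
Proof. exact: torus_liftX. Qed.

(** Quantifying over all larger finite sets allows two expansions to be compared on the union of
    their supports. *)
Lemma tcoef_expand x : exists S : {fset lat}, forall T : {fset lat},
  (S `<=` T)%fset -> x = \sum_(n <- T) tcoef n x *: X n.
Proof.
elim/X_ind: x => [m|a x y [S HS] [S' HS']].
  exists [fset m]%fset => T; rewrite fsub1set => mT.
  rewrite (big_fsetD1 m) //= tcoefX eqxx scale1r big_seq_cond big1 ?addr0 //.
  move=> n /andP[]; rewrite !inE => /andP[/negPf nm _] _.
  by rewrite tcoefX nm scale0r.
exists (S `|` S')%fset => T; rewrite fsubUset => /andP[ST ST'].
rewrite {1}(HS T ST) {1}(HS' T ST') scaler_sumr -big_split.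
by apply: eq_bigr => n _ /=; rewrite tcoef_lin scalerDl scalerA.
Qed.

Lemma tcoef_inj x y : (forall n, tcoef n x = tcoef n y) -> x = y.
Proof.
move=> xy; have [S HS] := tcoef_expand x; have [S' HS'] := tcoef_expand y.
rewrite (HS (S `|` S')%fset) ?fsubsetUl // (HS' (S `|` S')%fset) ?fsubsetUr //.
by apply: eq_bigr => n _; rewrite xy.
Qed.

Lemma tcoef_XM m n z : tcoef (m + n) (X m * z) = sigma q m n * tcoef n z.
Proof.
move: z; apply: (@torus_lin_ext K^o) => [a x y|a x y|k].
- by rewrite mulrDr -scalerAr tcoef_lin.
- rewrite tcoef_lin mulrDr; congr (_ + _); exact: mulrCA.
rewrite XM (linZ (tcoef_lin _)) !tcoefX (inj_eq (addrI m)).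
by case: eqP => [->|_]; rewrite ?scaler0 ?mulr0.
Qed.

Lemma tcoef_MX m n z : tcoef (m + n) (z * X m) = sigma q n m * tcoef n z.
Proof.
move: z; apply: (@torus_lin_ext K^o) => [a x y|a x y|k].
- by rewrite mulrDl -scalerAl tcoef_lin.
- rewrite tcoef_lin mulrDr; congr (_ + _); exact: mulrCA.
rewrite XM (linZ (tcoef_lin _)) !tcoefX addrC (inj_eq (addIr m)).
by case: eqP => [->|_]; rewrite ?scaler0 ?mulr0.
Qed.

(** The inverse of [X n]: the factor compensates [sigma q (- n) n = (sigma q n n)^-1]. *)
Definition tXV n : A := sigma q n n *: X (- n).

Lemma tXVK n : tXV n * X n = 1.
Proof.
by rewrite /tXV -scalerAl XM sigmaNl addNr scalerA divff ?sigma_neq0 ?scale1r.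
Qed.

Lemma tXKV n : X n * tXV n = 1.
Proof.
by rewrite /tXV -scalerAr XM sigmaNr subrr scalerA divff ?sigma_neq0 ?scale1r.
Qed.

(** * The projection onto the centre and logarithmic derivatives *)

Definition radproj : A -> A :=
  torus_lift (fun n => if `[< radf q n >] then X n else 0).

Lemma radproj_lin : linear radproj. Proof. exact: torus_lift_lin. Qed.

Lemma radprojX n : radproj (X n) = if `[< radf q n >] then X n else 0.
Proof. exact: torus_liftX. Qed.

Lemma rad_centralX r : radf q r -> forall a, X r * a = a * X r.
Proof.
move=> hr; apply: torus_lin_ext => [k x y|k x y|n].
- by rewrite mulrDr scalerAr.
- by rewrite mulrDl scalerAl.
by rewrite !XM (radf_sigma _ hr) addrC.
Qed.

Lemma radproj_centre x a : radproj x * a = a * radproj x.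
Proof.
move: x; apply: torus_lin_ext => [k x y|k x y|n].
- by rewrite radproj_lin mulrDl scalerAl.
- by rewrite radproj_lin mulrDr scalerAr.
rewrite radprojX; case: asboolP => [hr|_]; last by rewrite mulr0 mul0r.
exact: rad_centralX.
Qed.

(** On basis vectors both sides vanish unless [n + m] is in the radical, and then [radfD_sigma] says
    that [X n] and [X m] commute. *)
Lemma radproj_tracial x y : radproj (x * y) = radproj (y * x).
Proof.
move: x; apply: torus_lin_ext => [k x z|k x z|n].
- by rewrite mulrDl -scalerAl radproj_lin.
- by rewrite mulrDr -scalerAr radproj_lin.
move: y; apply: torus_lin_ext => [k x z|k x z|m].
- by rewrite mulrDr -scalerAr radproj_lin.
- by rewrite mulrDl -scalerAl radproj_lin.
rewrite !XM !(linZ radproj_lin) [m + n]addrC radprojX.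
by case: asboolP => [/radfD_sigma->|]; rewrite ?scaler0.
Qed.

Lemma tcoef_radproj n x :
  tcoef n (radproj x) = if `[< radf q n >] then tcoef n x else 0.
Proof.
move: x; apply: (@torus_lin_ext K^o) => [a x y|a x y|m].
- by rewrite radproj_lin tcoef_lin.
- by case: ifP => _; rewrite ?tcoef_lin // scaler0 addr0.
rewrite radprojX tcoefX; have [->|nm] := eqVneq n m.
  by case: ifP => _; rewrite ?tcoefX ?eqxx // (lin0 (tcoef_lin m)).
rewrite if_same; case: ifP => _; last exact: lin0 (tcoef_lin n).
by rewrite tcoefX (negPf nm).
Qed.

(** If [z] has a nonzero coefficient at [n], comparing the coefficients of [X m * z] and [z * X m]
    at [m + n] forces [n] into the radical. *)
Lemma radproj_id z : (forall a, z * a = a * z) -> radproj z = z.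
Proof.
move=> zC; apply: tcoef_inj => n; rewrite tcoef_radproj.
case: asboolP => // nr; have [->//|zn] := eqVneq (tcoef n z) 0.
case: nr; apply: radfE => m; apply: (mulIf zn).
by rewrite -tcoef_MX -tcoef_XM zC.
Qed.

Lemma mulX_inj n x y : X n * x = X n * y -> x = y.
Proof.
by move=> e; rewrite -[x]mul1r -(tXVK n) -mulrA e mulrA tXVK mul1r.
Qed.

(* The central part of the logarithmic derivative t^-n D(t^n); for n = e_j this
   is f_j(D). *)
Definition ldlog D n : A := radproj (tXV n * D (X n)).

Lemma ldlog_centre D n a : ldlog D n * a = a * ldlog D n.
Proof. exact: radproj_centre. Qed.

Lemma ldlog_lin n : linear (ldlog^~ n).
Proof.
move=> k D E; rewrite /ldlog [(k *: D + E) (X n)]/=.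
by rewrite mulrDr -scalerAr radproj_lin.
Qed.

(** The Leibniz rule on [X n * X m] leaves one term conjugated by [X m]; the trace property of
    [radproj] removes the conjugation. *)
Lemma ldlogD D n m : ldlog D (n + m) = ldlog D n + ldlog D m.
Proof.
have s0 := sigma_neq0 q n m.
have VD : tXV (n + m) = sigma q n m *: (tXV m * tXV n).
  apply: (mulX_inj (n := n + m)); rewrite tXKV -[X (n + m)](scalerK s0) -XM.
  rewrite -scalerAl -scalerAr scalerA mulVf // scale1r.
  by rewrite mulrA -[X n * _ * _]mulrA tXKV mulr1 tXKV.
rewrite /ldlog VD -[X (n + m)](scalerK s0) -XM (linZ (der_linear D)).
rewrite -scalerAl -scalerAr scalerA divff // scale1r derM mulrDr.
rewrite (linD radproj_lin); congr (_ + _).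
  by rewrite -mulrA (radproj_tracial (tXV m)) -!mulrA tXKV mulr1.
by rewrite mulrA -[tXV m * _ * _]mulrA tXVK mulr1.
Qed.

Lemma ldlog_delta D n :
  ldlog D n = \sum_j (n 0 j)%:~R *: ldlog D (delta_mx 0 j).
Proof.
have ldB m m' : ldlog D (m - m') = ldlog D m - ldlog D m'.
  by apply: (addIr (ldlog D m')); rewrite -ldlogD !subrK.
pose g : {additive lat -> A} :=
  HB.pack (ldlog D) (GRing.isZmodMorphism.Build lat A (ldlog D) ldB).
have -> : ldlog D n = g n by [].
rewrite {1}[n]matrix_sum_delta big_ord1 raddf_sum; apply: eq_bigr => j _.
by rewrite -[ldlog D _]/(g _) scaler_int -raddfMz -scaler_int intz.
Qed.

(* For k outside the radical choose m with t^m t^k = c t^k t^m and c <> 1;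
   applying D and projecting [t^-m (-)] gives (1 - c) radproj (D t^k) = 0. *)
Lemma radproj_der D x : radproj (D x) = D (radproj x).
Proof.
move: x; apply: torus_lin_ext => [a x y|a x y|k].
- by rewrite der_linear radproj_lin.
- by rewrite radproj_lin der_linear.
rewrite radprojX; case: asboolP => [hk|nk].
  by apply: radproj_id; apply: der_centre; exact: rad_centralX.
rewrite (lin0 (der_linear D)).
have [m hm] : exists m, sigma q k m != sigma q m k.
  apply: contrapT => h; apply: nk; apply: radfE => m.
  by apply/eqP/negP => /negP hm; apply: h; exists m.
set c := sigma q m k / sigma q k m.
have c1 : 1 - c != 0.
  rewrite subr_eq0 eq_sym; apply: contra hm => /eqP e.
  by rewrite eq_sym; apply/eqP/divr1_eq.
have XkE : X m * X k = c *: (X k * X m).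
  by rewrite !XM scalerA divfK ?sigma_neq0 // [m + k]addrC.
have XkV : X k * tXV m = c *: (tXV m * X k).
  apply: (mulX_inj (n := m)); rewrite mulrA XkE -scalerAl -mulrA tXKV mulr1.
  by rewrite -scalerAr mulrA tXKV mul1r.
have := congr1 (fun y => radproj (tXV m * D y)) XkE.
rewrite derM (linZ (der_linear D)) derM -scalerAr !mulrDr (linZ radproj_lin).
rewrite !(linD radproj_lin) [tXV m * (X m * D (X k))]mulrA tXVK mul1r.
rewrite (radproj_tracial (tXV m)) -[D (X m) * X k * _]mulrA XkV -scalerAr.
rewrite (linZ radproj_lin) (radproj_tracial (tXV m) (D (X k) * X m)).
rewrite -[D (X k) * X m * _]mulrA tXKV mulr1.
rewrite [tXV m * (X k * _)]mulrA (radproj_tracial (tXV m * X k)).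
rewrite scalerDr addrC => /addIr e; apply: (scalerI c1).
by rewrite scaler0 scalerBl scale1r -e subrr.
Qed.

(** With [D (X n) = X n * a] and [E (X n) = X n * b], the bracket sends [X n] to
    [X n * (D b - E a + a * b - b * a)]. The trace property kills the commutator, and [radproj]
    commutes with [D] and [E]. *)
Lemma ldlog_bracket D E n :
  ldlog (der_bracket D E) n = D (ldlog E n) - E (ldlog D n).
Proof.
rewrite /ldlog; set a := tXV n * D (X n); set b := tXV n * E (X n).
have DX : D (X n) = X n * a by rewrite mulrA tXKV mul1r.
have EX : E (X n) = X n * b by rewrite mulrA tXKV mul1r.
rewrite [der_bracket D E (X n)]/=; move: a b DX EX => a b DX EX.
rewrite EX DX !derM DX EX -!mulrA -!mulrDr.
rewrite -mulrBr mulrA tXVK mul1r opprD addrACA (linD radproj_lin).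
rewrite !(linB radproj_lin) (radproj_tracial a) subrr add0r.
by rewrite !radproj_der.
Qed.

(** * Degree derivations and values of the logarithmic derivative *)

Variable p : 'I_d -> der A.
Hypothesis pX : forall i n, p i (X n) = (n 0 i)%:~R *: X n.

Lemma degree_comm i j a : p i (p j a) = p j (p i a).
Proof.
move: a; apply: torus_lin_ext => [k x y|k x y|n]; rewrite ?der_linear //.
by rewrite !pX !(linZ (der_linear _)) !pX !scalerA mulrC.
Qed.

Lemma der_on_centre D z : (forall a, z * a = a * z) ->
  D z = \sum_j ldlog D (delta_mx 0 j) * p j z.
Proof.
(* Writing [z] as [radproj z] makes the identity linear in an unrestricted [z], hence testable on
   the basis. *)
move/radproj_id <-; move: z; apply: torus_lin_ext => [k x y|k x y|n].
- by rewrite radproj_lin der_linear.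
- rewrite scaler_sumr -big_split; apply: eq_bigr => j _ /=.
  by rewrite radproj_lin der_linear mulrDr scalerAr.
rewrite radprojX; case: asboolP => hr; last first.
  rewrite (lin0 (der_linear D)) big1 // => j _.
  by rewrite (lin0 (der_linear _)) mulr0.
(* For [n] in the radical, [tXV n * D (X n)] is already central, so the projection in [ldlog] fixes
   it. *)
have -> : D (X n) = X n * ldlog D n.
  have DC := der_centre D (rad_centralX hr).
  rewrite /ldlog radproj_id ?mulrA ?tXKV ?mul1r // => a.
  rewrite -mulrA DC mulrA /tXV -!scalerAl (rad_centralX (radfN hr)).
  by rewrite -scalerAr mulrA.
rewrite ldlog_delta mulr_sumr; apply: eq_bigr => j _.
by rewrite pX -!scalerAr ldlog_centre.
Qed.

(** By the trace property, [a] and its conjugate by [X n] have the same projection. *)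
Lemma ldlog_ad a n : ldlog (ad a) n = 0.
Proof.
rewrite /ldlog [ad a (X n)]/= mulrBr (linB radproj_lin).
by rewrite radproj_tracial -mulrA tXKV mulr1 mulrA tXVK mul1r subrr.
Qed.

Lemma ldlog_degree D (u : 'rV[K]_d) r j : radf q r ->
  (forall x, D x = X r * \sum_i u 0 i *: p i x) ->
  ldlog D (delta_mx 0 j) = u 0 j *: X r.
Proof.
move=> hr DE; rewrite /ldlog DE (bigD1 j) //= big1 ?addr0 => [|i ij].
  rewrite pX mxE !eqxx scale1r -!scalerAr (rad_centralX hr) mulrA tXVK mul1r.
  by rewrite (linZ radproj_lin) radprojX asboolT.
by rewrite pX mxE (negPf ij) andbF scale0r scaler0.
Qed.

(** * The action on the tensor product and its homogeneous components *)

Section Action.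
Variables (V W : lmodType K) (tens : V -> A -> W).
Variables (rhoV : 'M[K]_d -> V -> V) (alpha : 'rV[K]_d).
Hypothesis hW : is_tensor_product tens.
Hypothesis hV : lie_module (@gl_bracket K d) rhoV.

Let b1 v : linear (tens v). Proof. exact: (hW.1.2 v). Qed.
Let b2 a : linear (tens^~ a). Proof. exact: (hW.1.1 a). Qed.

(** The formula for [ad (X s)] holds for every [s]: in the radical both sides vanish. [D(u, r)]
    enters as any derivation given by the defining formula. *)
Lemma torus_lie_module : exists rho : der A * A -> W -> W,
  [/\ lie_module (@semidirect_bracket K A) rho,
    forall s v n, rho (ad (X s), 0) (tens v (X n)) =
      (sigma q s n - sigma q n s) *: tens v (X (n + s)),
    forall D (u : 'rV[K]_d) r, radf q r ->
      (forall x, D x = X r * \sum_i u 0 i *: p i x) ->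
      forall v n, rho (D, 0) (tens v (X n)) = sigma q r n *:
        tens (pairing u (zvec K n + alpha) *: v + rhoV (outer r u) v)
             (X (r + n))
  & forall m v n,
      rho (0, X m) (tens v (X n)) = sigma q m n *: tens v (X (m + n))].
Proof.
have [rho [lrho rhoE]] := @twisted_lie_module K A d V W tens rhoV alpha p
  (fun D j => ldlog D (delta_mx 0 j)) hW hV (fun j => ldlog_lin _)
  (fun D j => ldlog_centre D _) (fun D E j => ldlog_bracket D E _)
  der_on_centre degree_comm.
exists rho; split=> // [s v n|D u r hr DE v n|m v n];
  rewrite rhoE /twisted_fun /=.
- rewrite !big1 => [|e _|j _]; last by rewrite ldlog_ad scaler0.
    by rewrite !mul0r !addr0 !XM [s + n]addrC -scalerBl (linZ (b1 v)).
  by rewrite ldlog_ad (lin0 (der_linear _)) mul0r (lin0 (b1 _)).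
- have lD := ldlog_degree _ hr DE.
  rewrite DE mul0r addr0 (linD (b2 _)) scalerDr; congr (_ + _).
    rewrite (linZ (b2 _)) -(linZ (b1 _)) -(linZ (b1 _)); congr (tens v _).
    rewrite scalerA mulrC -scalerA -XM mulr_sumr mulr_suml.
    rewrite -big_split /pairing scaler_suml; apply: eq_bigr => j _ /=.
    rewrite pX lD !mxE mulrDr scalerDl -!scalerAr scalerA; congr (_ + _).
    by rewrite scalerA -scalerAl [alpha _ _ * _]mulrC.
  (* Since [ldlog D] at the j-th unit vector is [u 0 j *: X r], its degree derivatives bring out the
     factors [r 0 i], which gives the entries of [outer r u]. *)
  transitivity (\sum_(e : 'I_d * 'I_d)
      (((r 0 e.1)%:~R * u 0 e.2) * sigma q r n) *:
      tens (rhoV (delta_mx e.1 e.2) v) (X (r + n))).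
    apply: eq_bigr => e _; rewrite lD (linZ (der_linear _)) pX scalerA.
    by rewrite -scalerAl XM scalerA (linZ (b1 _)) [u _ _ * _]mulrC.
  have lM : linear (rhoV^~ v) := hV.1.1 v.
  rewrite -(pair_bigA _ (fun i j => ((r 0 i)%:~R * u 0 j * sigma q r n) *:
    tens (rhoV (delta_mx i j) v) (X (r + n)))) /=.
  rewrite [outer r u]matrix_sum_delta (lin_sum lM) (lin_sum (b2 _)) scaler_sumr.
  apply: eq_bigr => i _; rewrite (lin_sum lM) (lin_sum (b2 _)) scaler_sumr.
  apply: eq_bigr => j _; rewrite (linZ lM) (linZ (b2 _)) scalerA mxE.
  by rewrite [sigma q r n * _]mulrC.
have l0 j : ldlog 0 (delta_mx 0 j) = 0 by exact: lin0 (ldlog_lin _).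
rewrite !big1 => [|e _|j _]; last by rewrite l0 scaler0.
  by rewrite mul0r !addr0 XM add0r (linZ (b1 v)).
by rewrite l0 (lin0 (der_linear _)) mul0r (lin0 (b1 _)).
Qed.

(** The components come from lifting the bilinear maps [tcoef n a *: v] to [W]; as for
    [tcoef_expand], the induction treats all larger supports at once. *)
Lemma tensor_expand w : exists (c : lat -> V) (S : {fset lat}),
  w = \sum_(n <- S) tens (c n) (X n).
Proof.
have cb n : bilinear_for *:%R *:%R (fun (v : V) a => (tcoef n a : K) *: v).
  split=> u k x y /=; first by rewrite scalerDr !scalerA mulrC.
  by rewrite tcoef_lin scalerDl scalerA.
have [c cP] := choice (fun n => tensor_lift hW (cb n)).
have lc n : linear (c n) := (cP n).1.
exists (c ^~ w).
suff [S HS] : exists S : {fset lat}, forall T : {fset lat}, (S `<=` T)%fset ->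
    w = \sum_(n <- T) tens (c n w) (X n).
  by exists S; exact: HS.
move: w; apply: (tensor_ind hW) => [a w w' [S HS] [S' HS']|v a].
  exists (S `|` S')%fset => T; rewrite fsubUset => /andP[ST ST'].
  rewrite {1}(HS T ST) {1}(HS' T ST') scaler_sumr -big_split.
  by apply: eq_bigr => n _ /=; rewrite lc (b2 _).
have [S HS] := tcoef_expand a; exists S => T ST.
rewrite {1}(HS T ST) (lin_sum (b1 v)); apply: eq_bigr => n _.
by rewrite (cP n).2 (linZ (b1 v)) (linZ (b2 _)).
Qed.

Lemma tens_neq0 v n : tens v (X n) = 0 -> v = 0.
Proof.
have cb : bilinear_for *:%R *:%R (fun (v : V) a => (tcoef n a : K) *: v).
  split=> u k x y /=; first by rewrite scalerDr !scalerA mulrC.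
  by rewrite tcoef_lin scalerDl scalerA.
have [c [lc cE]] := tensor_lift hW cb.
by move/(congr1 c); rewrite cE (lin0 lc) tcoefX eqxx scale1r.
Qed.

(** * Graded submodules and irreducibility *)

Section Irreducible.
Variables (L : lmodType K) (rho : L -> W -> W).
Hypothesis char0 : forall k : int, k%:~R = 0 :> K -> k = 0.
Hypothesis hVirr : irreducible rhoV.
Hypothesis rho_lin : forall x, linear (rho x).
Hypothesis rho_tX : forall m, exists x, forall v n,
  rho x (tens v (X n)) = sigma q m n *: tens v (X (m + n)).
Hypothesis rho_D : forall u r, radf q r -> exists x, forall v n,
  rho x (tens v (X n)) = sigma q r n *:
    tens (pairing u (zvec K n + alpha) *: v + rhoV (outer r u) v) (X (r + n)).

Let lM v : linear (rhoV^~ v). Proof. exact: hV.1.1 v. Qed.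

Lemma degree_operator i : exists x, forall v n,
  rho x (tens v (X n)) = ((n 0 i)%:~R + alpha 0 i) *: tens v (X n).
Proof.
have [x xE] := rho_D (delta_mx 0 i) (radf0 q); exists x => v n.
have -> : (n 0 i)%:~R + alpha 0 i = pairing (delta_mx 0 i) (zvec K n + alpha).
  rewrite /pairing (bigD1 i) //= big1 ?addr0 => [|j ji].
    by rewrite !mxE !eqxx mul1r.
  by rewrite !mxE (negPf ji) andbF mul0r.
have o0 : outer 0 (delta_mx 0 i) = 0 :> 'M[K]_d.
  by apply/matrixP => a b; rewrite !mxE mul0r.
by rewrite xE sigma0l scale1r add0r o0 (lin0 (lM _)) addr0 (linZ (b2 _)).
Qed.

(** Induction on [s]: with [i] separating [n] from [m], the i-th degree operator minus its
    eigenvalue at [m] removes the term of degree [m] and multiplies that of degree [n] by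
    [n 0 i - m 0 i], invertible by [char0]. *)
Lemma homogeneous_component P (s : seq lat) n (c : lat -> V) :
  submodule rho P -> n \notin s ->
  P (tens (c n) (X n) + \sum_(m <- s) tens (c m) (X m)) -> P (tens (c n) (X n)).
Proof.
case=> P0 PD Prho; elim: s c => [|m s IH] c; first by rewrite big_nil addr0.
rewrite inE negb_or => /andP[nm ns] Pw.
have [i nmi] : exists i, n 0 i != m 0 i.
  apply: contrapT => h; case/eqP: nm; apply/rowP => i.
  by apply/eqP/negP => /negP ?; apply: h; exists i.
have [x xE] := degree_operator i.
pose c' (k : lat) := (k 0 i - m 0 i)%:~R *: c k.
have : P (tens (c' n) (X n) + \sum_(k <- s) tens (c' k) (X k)).
  have -> : tens (c' n) (X n) + \sum_(k <- s) tens (c' k) (X k) =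
      - ((m 0 i)%:~R + alpha 0 i) *:
        (tens (c n) (X n) + \sum_(k <- m :: s) tens (c k) (X k)) +
      rho x (tens (c n) (X n) + \sum_(k <- m :: s) tens (c k) (X k)).
    have E k : tens (c' k) (X k) = - ((m 0 i)%:~R + alpha 0 i) *:
        tens (c k) (X k) + rho x (tens (c k) (X k)).
      rewrite xE (linZ (b2 _)) -scalerDl; congr (_ *: _).
      by rewrite intrB opprD [RHS]addrC [RHS]addrACA subrr addr0.
    rewrite (linD (rho_lin x)) scalerDr addrACA -E; congr (_ + _).
    rewrite (lin_sum (rho_lin x)) scaler_sumr -big_split big_cons /= -E.
    rewrite /c' subrr scale0r (lin0 (b2 _)) add0r.
    by apply: eq_bigr => k _; rewrite -E.
  by apply: (PD) => //; exact: Prho.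
move/(IH _ ns); rewrite (linZ (b2 _)) => Pn.
have nm0 : (n 0 i - m 0 i)%:~R != 0 :> K.
  by apply/eqP => /char0/eqP; rewrite subr_eq0 (negPf nmi).
rewrite -[tens _ _](scalerK nm0) -[_ *: _]addr0.
exact: PD.
Qed.

Lemma submodule_homogeneous P : submodule rho P -> forall w, P w ->
  exists (c : lat -> V) (S : {fset lat}), w = \sum_(n <- S) tens (c n) (X n) /\
    forall n, n \in S -> P (tens (c n) (X n)).
Proof.
move=> hP w Pw; have [c [S wE]] := tensor_expand w.
exists c, S; split=> // n nS.
apply: (homogeneous_component (s := rem n S) (c := c) hP).
  by rewrite mem_rem_uniq ?fset_uniq // !inE eqxx.
by rewrite wE (big_rem n) in Pw.
Qed.

Lemma torus_irreducible : irreducible rho.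
Proof.
split.
  case: hVirr => -[v v0] _; exists (tens v (X 0)) => /tens_neq0.
  exact: v0.
move=> P hP; have [P0 PD Prho] := hP.
have PZ a w : P w -> P (a *: w) by rewrite -[a *: w]addr0 => Pw; exact: PD.
have PB w w' : P w -> P w' -> P (w - w').
  by move=> Pw Pw'; rewrite addrC -scaleN1r; exact: PD.
have shift v n m : P (tens v (X n)) -> P (tens v (X m)).
  have [x xE] := rho_tX (m - n).
  move/(Prho x); rewrite xE subrK => /(PZ (sigma q (m - n) n)^-1).
  by rewrite scalerK ?sigma_neq0.
(* By [shift], degree 0 represents every degree. *)
pose P' v := P (tens v (X 0)).
have [N N0 qN] := qentry_common_order q.
have NK : N%:R != 0 :> K.
  by apply/eqP => /(char0 (k := N)) [] N1; rewrite N1 in N0.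
have hP' : submodule rhoV P'.
  split=> [|a v v' Pv Pv'|M v Pv]; rewrite /P'.
  - by rewrite (lin0 (b2 _)).
  - by rewrite (b2 _); exact: PD.
  have PE i j : P (tens (rhoV (delta_mx i j) v) (X 0)).
    have hr := radfMn (delta_mx 0 i) qN.
    have [x xE] := rho_D (delta_mx 0 j) hr.
    have := Prho x _ Pv; rewrite xE => /(PZ (sigma q (delta_mx 0 i *+ N) 0)^-1).
    rewrite scalerK ?sigma_neq0 // => /(shift _ _ 0).
    rewrite (linD (b2 _)) (linZ (b2 _)) => Pw.
    (* Once the vector is shifted back to degree 0, subtracting the scalar part leaves [N] times the
       matrix unit, and [NK] permits division by [N]. *)
    have := PB _ _ Pw (PZ (pairing (delta_mx 0 j) (zvec K 0 + alpha)) _ Pv).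
    rewrite addrC addKr.
    have -> : outer (delta_mx 0 i *+ N) (delta_mx 0 j) =
        N%:R *: delta_mx i j :> 'M[K]_d.
      apply/matrixP => k l; rewrite !mxE mulmxnE !mxE !eqxx /=.
      rewrite rmorphMn -mulr_natl -mulrA; congr (_ * _).
      by case: (k == i); case: (l == j); rewrite ?mulr0 ?mulr1.
    by rewrite (linZ (lM v)) (linZ (b2 _)) => /(PZ N%:R^-1); rewrite scalerK.
  rewrite [M]matrix_sum_delta (lin_sum (lM v)) (lin_sum (b2 _)).
  elim/big_rec: _ => // i w _ Pw.
  rewrite -[X in X + _]scale1r; apply: (PD) => //.
  rewrite (lin_sum (lM v)) (lin_sum (b2 _)).
  elim/big_rec: _ => // j w' _ Pw'; rewrite (linZ (lM v)) (linZ (b2 _)).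
  exact: PD.
have [V0|V1] := hVirr.2 _ hP'.
  left=> w /(submodule_homogeneous hP)[c [S [-> Pc]]].
  apply: big1_seq => n /andP[_ nS].
  by rewrite (V0 (c n)) ?(lin0 (b2 _)) //; apply: shift (Pc n nS).
right=> w; have [c [S ->]] := tensor_expand w.
elim/big_rec: _ => // n w' _ Pw'.
rewrite -[X in X + _]scale1r; apply: (PD) => //.
exact: shift (V1 (c n)).
Qed.

End Irreducible.

End Action.

End TorusBasis.

(** * Specialization to the concrete quantum torus *)

Definition degree_der (K : fieldType) (d : nat) (q : qmatrix K d) (i : 'I_d) :
  der (qtorus q) := to_der (degree_subproof q i).

Lemma qtorus_lift (K : fieldType) (d : nat) (q : qmatrix K d) (M : lmodType K)
    (g : 'rV[int]_d -> M) :
  exists2 h : qtorus q -> M, linear h & forall n, h (tX q n) = g n.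
Proof.
by exists (qlift g) => [|n]; [exact: qlift_is_linear | exact: qliftX].
Qed.

Theorem proposition2p4 (R : realType) (d : nat) (q : qmatrix R[i] d)
    (V : vectType R[i]) (rhoV : 'M[R[i]]_d -> V -> V)
    (hV : lie_module (@gl_bracket R[i] d) rhoV)
    (hVirr : irreducible rhoV)
    (alpha : 'rV[R[i]]_d)
    (W : lmodType R[i]) (tens : V -> qtorus q -> W)
    (hW : is_tensor_product tens) :
  exists rho : der (qtorus q) * qtorus q -> W -> W,
    [/\ lie_module (@semidirect_bracket R[i] (qtorus q)) rho,
        forall s, ~ radf q s -> forall v n,
          rho (ad (tX q s), 0) (tens v (tX q n)) =
          (sigma q s n - sigma q n s) *: tens v (tX q (n + s)),
        forall r (hr : radf q r) u v n,
          rho (torusD u hr, 0) (tens v (tX q n)) =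
          sigma q r n *:
            tens (pairing u (zvec R[i] n + alpha) *: v + rhoV (outer r u) v)
                 (tX q (r + n)),
        forall m v n,
          rho (0, tX q m) (tens v (tX q n)) =
          sigma q m n *: tens v (tX q (m + n))
      & irreducible rho].
Proof.
have X_ind := @qt_ind _ _ q; have X_lift := @qtorus_lift _ _ q.
have pX i n : degree_der q i (tX q n) = (n 0 i)%:~R *: tX q n.
  exact: degree_funX.
have [rho [lrho rho_ad rho_D rho_X]] :=
  torus_lie_module (tX0 q) (@tXM _ _ q) X_ind X_lift pX alpha hW hV.
(* [torusD u hr] is by definition the map required of [D], hence [erefl]. *)
have rhoD r (hr : radf q r) u := rho_D (torusD u hr) u r hr (fun x => erefl).
exists rho; split.
- exact: lrho.
- by move=> s _ v n; exact: rho_ad.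
- by move=> r hr u v n; exact: rhoD.
- exact: rho_X.
apply: (torus_irreducible X_ind X_lift hW hV _ hVirr (alpha := alpha)).
- by move=> k /eqP; rewrite intr_eq0 => /eqP.
- by move=> x; exact: lrho.1.2.
- by move=> m; exists (0, tX q m) => v n; exact: rho_X.
by move=> u r hr; exists (torusD u hr, 0) => v n; exact: rhoD.
Qed.
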